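(* Let $j_1,j_2$ be positive integers. If $j_1\neq j_2$, then $E(j_1)$ and $E(j_2)$ are not isomorphic as affine bundles over $Z_{-1}$.
   Context: $Z_{-1}=\mathrm{Tot}(\mathcal{O}_{\mathbb{P}^1}(1))$ is the complex surface obtained by gluing $\mathbb{C}^2_{\{z,u_2\}}$ and $\mathbb{C}^2_{\{\xi,v_2\}}$ by $(\xi,v_2)=(z^{-1},z^{-1}u_2)$ for $z,\xi\neq 0$. For a positive integer $j$, let $\mathcal{W}_3(j)$ be the complex threefold obtained by gluing $\mathbb{C}^3_{\{z,u_1,u_2\}}$ and $\mathbb{C}^3_{\{\xi,v_1,v_2\}}$ by $(\xi,v_1,v_2)=(z^{-1},\,z^3u_1+z^2u_2^j,\,z^{-1}u_2)$ for $z,\xi\ne0$; $E(j)$ is $\mathcal{W}_3(j)$ regarded as the total space of a rank 1 affine bundle over $Z_{-1}$, where the projection is onto the first and third coordinates and the transition function in the fiber coordinate is $u_1\mapsto z^3u_1+z^2u_2^j$. An isomorphism of affine bundles $T\colon E(j_1)\to E(j_2)$ is a map over $Z_{-1}$ which is an affine transformation on each fiber: there are holomorphic functions $A^U\colon\mathbb{C}^2_{z,u_2}\to\mathbb{C}\setminus\{0\}$, $A^V\colon\mathbb{C}^2_{\xi,v_2}\to\mathbb{C}\setminus\{0\}$, $b^U\colon\mathbb{C}^2_{z,u_2}\to\mathbb{C}$, $b^V\colon\mathbb{C}^2_{\xi,v_2}\to\mathbb{C}$ such that $T$ is $u_1\mapsto A^Uu_1+b^U$ on the first chart and $v_1\mapsto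 A^Vv_1+b^V$ on the second, these expressions being compatible with the transition functions of $E(j_1)$ and $E(j_2)$. *)

(* Defs.v *)
From Stdlib Require Import Reals ClassicalEpsilon FunctionalExtensionality
  PropExtensionality ProofIrrelevance.
From Coquelicot Require Import Coquelicot.
Open Scope C_scope.

(* The norm on C * C is the one over C_AbsRing, so the differential is required
   to be C-linear: this is complex Frechet differentiability at every point. *)
Definition holomorphic2 (f : C * C -> C) : Prop :=
  forall x : C * C,
    @ex_filterdiff C_AbsRing
      (prod_NormedModule C_AbsRing C_NormedModule C_NormedModule)
      C_NormedModule f (locally x).

(* Points of a quotient X / R are the classes, as predicates on X. *)
Definition quot {X : Type} (R : X -> X -> Prop) : Type :=
  { S : X -> Prop | exists x : X, S = R x }.

Definition class {X : Type} (R : X -> X -> Prop) (x : X) : quot R :=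
  exist _ (R x) (ex_intro _ x eq_refl).

Definition repr {X : Type} (R : X -> X -> Prop) (p : quot R) : X :=
  proj1_sig (constructive_indefinite_description _ (proj2_sig p)).

Lemma class_repr (X : Type) (R : X -> X -> Prop) (p : quot R) :
  class R (repr R p) = p.
Proof.
unfold repr; destruct p as [S HS]; cbn.
destruct (constructive_indefinite_description _ HS) as [x Hx]; cbn.
apply subset_eq_compat; symmetry; exact Hx.
Qed.

Lemma class_eq (X : Type) (R : X -> X -> Prop)
  (Rrefl : forall x, R x x) (Rsym : forall x y, R x y -> R y x)
  (Rtrans : forall x y z, R x y -> R y z -> R x z) (x y : X) :
  class R x = class R y <-> R x y.
Proof.
split; intro H.
- apply (f_equal (@proj1_sig _ _)) in H; cbn in H; rewrite H; apply Rrefl.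
- apply subset_eq_compat, functional_extensionality; intro z.
  apply propositional_extensionality; split; intro K.
  + exact (Rtrans y x z (Rsym x y H) K).
  + exact (Rtrans x y z H K).
Qed.

(* Gluing of the charts X and Y along phi, defined on the part D of X. *)
Inductive glue {X Y : Type} (D : X -> Prop) (phi : X -> Y) :
  X + Y -> X + Y -> Prop :=
| glue_refl (p : X + Y) : glue D phi p p
| glue_UV (x : X) : D x -> glue D phi (inl x) (inr (phi x))
| glue_VU (x : X) : D x -> glue D phi (inr (phi x)) (inl x).

Lemma glue_sym (X Y : Type) (D : X -> Prop) (phi : X -> Y) (p q : X + Y) :
  glue D phi p q -> glue D phi q p.
Proof. intros []; now constructor. Qed.

Lemma glue_trans (X Y : Type) (D : X -> Prop) (phi : X -> Y)
  (phi_inj : forall x x', D x -> D x' -> phi x = phi x' -> x = x')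
  (p q r : X + Y) :
  glue D phi p q -> glue D phi q r -> glue D phi p r.
Proof.
intros H; destruct H as [p | x Hx | x Hx]; intro K; trivial.
- inversion K as [| | x' Hx' E]; subst; [now constructor |].
  rewrite (phi_inj _ _ Hx' Hx E); constructor.
- inversion K; subst; now constructor.
Qed.

Definition Z_dom (x : C * C) : Prop := let '(z, _) := x in z <> 0.

Definition Z_trans (x : C * C) : C * C :=
  let '(z, u2) := x in (/ z, / z * u2).

Definition W_dom (x : C * C * C) : Prop := let '(z, _, _) := x in z <> 0.

Definition W_trans (j : nat) (x : C * C * C) : C * C * C :=
  let '(z, u1, u2) := x in (/ z, z ^ 3 * u1 + z ^ 2 * u2 ^ j, / z * u2).

Definition Z_glue : C * C + C * C -> C * C + C * C -> Prop :=
  glue Z_dom Z_trans.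

Definition W_glue (j : nat) :
  C * C * C + C * C * C -> C * C * C + C * C * C -> Prop :=
  glue W_dom (W_trans j).

Definition Zm1 : Type := quot Z_glue.

Definition E (j : nat) : Type := quot (W_glue j).

Definition E_U (j : nat) (z u1 u2 : C) : E j :=
  class (W_glue j) (inl (z, u1, u2)).

Definition E_V (j : nat) (xi v1 v2 : C) : E j :=
  class (W_glue j) (inr (xi, v1, v2)).

Definition chart_proj (p : C * C * C + C * C * C) : C * C + C * C :=
  match p with
  | inl (z, _, u2) => inl (z, u2)
  | inr (xi, _, v2) => inr (xi, v2)
  end.

(* Independent of the representative, by E_proj_class. *)
Definition E_proj (j : nat) (p : E j) : Zm1 :=
  class Z_glue (chart_proj (repr (W_glue j) p)).

Lemma Cinv_inj (z w : C) : z <> 0 -> w <> 0 -> / z = / w -> z = w.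
Proof.
intros Hz Hw H.
replace z with (w * (z * / w)) by (field; exact Hw).
rewrite <- H; field; exact Hz.
Qed.

Lemma Cmult_inj (a z w : C) : a <> 0 -> a * z = a * w -> z = w.
Proof.
intros Ha H.
replace z with (/ a * (a * z)) by (field; exact Ha).
rewrite H; field; exact Ha.
Qed.

Lemma Z_trans_inj (x x' : C * C) :
  Z_dom x -> Z_dom x' -> Z_trans x = Z_trans x' -> x = x'.
Proof.
destruct x as [z u], x' as [z' u']; unfold Z_dom, Z_trans; intros Hz Hz' H.
assert (H1 : / z = / z') by congruence.
assert (H2 : / z * u = / z' * u') by congruence.
assert (Ez : z = z') by now apply Cinv_inj.
subst z'; f_equal.
replace u with (z * (/ z * u)) by (field; exact Hz).
rewrite H2; field; exact Hz.
Qed.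

Lemma W_trans_inj (j : nat) (x x' : C * C * C) :
  W_dom x -> W_dom x' -> W_trans j x = W_trans j x' -> x = x'.
Proof.
destruct x as [[z u1] u2], x' as [[z' u1'] u2'].
unfold W_dom, W_trans; intros Hz Hz' H.
assert (Hb : (z, u2) = (z', u2')).
{ apply Z_trans_inj; trivial; unfold Z_trans; congruence. }
assert (z' = z) as -> by congruence.
assert (u2' = u2) as -> by congruence.
assert (H1 : z ^ 3 * u1 + z ^ 2 * u2 ^ j = z ^ 3 * u1' + z ^ 2 * u2 ^ j)
  by congruence.
replace u1' with u1; [reflexivity |].
apply (Cmult_inj (z ^ 3)); [now apply Cpow_nz |].
replace (z ^ 3 * u1)
  with (z ^ 3 * u1 + z ^ 2 * u2 ^ j - z ^ 2 * u2 ^ j) by ring.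
rewrite H1; ring.
Qed.

Lemma Z_class_eq (p q : C * C + C * C) :
  class Z_glue p = class Z_glue q <-> Z_glue p q.
Proof.
apply class_eq; [constructor | apply glue_sym |].
apply glue_trans, Z_trans_inj.
Qed.

Lemma W_class_eq (j : nat) (p q : C * C * C + C * C * C) :
  class (W_glue j) p = class (W_glue j) q <-> W_glue j p q.
Proof.
apply class_eq; [constructor | apply glue_sym |].
apply glue_trans, W_trans_inj.
Qed.

Lemma E_proj_class (j : nat) (p : C * C * C + C * C * C) :
  E_proj j (class (W_glue j) p) = class Z_glue (chart_proj p).
Proof.
apply Z_class_eq.
assert (H : W_glue j (repr (W_glue j) (class (W_glue j) p)) p).
{ apply W_class_eq, class_repr. }
destruct H as [q | [[z u1] u2] Hz | [[z u1] u2] Hz]; cbn.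
- constructor.
- exact (glue_UV Z_dom Z_trans (z, u2) Hz).
- exact (glue_VU Z_dom Z_trans (z, u2) Hz).
Qed.

(* Compatibility of the chart expressions with the transition functions is
   carried by T being a single map between the glued spaces.  T is invertible
   since AU and AV have no zeros. *)
Definition affine_bundle_iso (j1 j2 : nat) (T : E j1 -> E j2) : Prop :=
  (forall p : E j1, E_proj j2 (T p) = E_proj j1 p) /\
  exists AU AV bU bV : C * C -> C,
    holomorphic2 AU /\ holomorphic2 AV /\
    holomorphic2 bU /\ holomorphic2 bV /\
    (forall x, AU x <> 0) /\ (forall y, AV y <> 0) /\
    (forall z u1 u2 : C,
       T (E_U j1 z u1 u2) = E_U j2 z (AU (z, u2) * u1 + bU (z, u2)) u2) /\
    (forall xi v1 v2 : C,
       T (E_V j1 xi v1 v2) = E_V j2 xi (AV (xi, v2) * v1 + bV (xi, v2)) v2).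

Definition affine_isomorphic (j1 j2 : nat) : Prop :=
  exists T : E j1 -> E j2, affine_bundle_iso j1 j2 T.

(* Main.v *)
Require Import Defs.
From Stdlib Require Import Reals Lra Lia ClassicalEpsilon.
From Coquelicot Require Import Coquelicot.
Local Open Scope C_scope.

(** Comparing the two charts, an isomorphism of affine bundles yields the
two identities, for z <> 0,
  AU(z,u) = AV(1/z, u/z)   and
  z^3 bU(z,u) + z^2 (u^j2 - AU(z,u) u^j1) = bV(1/z, u/z).
For fixed u, the first one says that the entire function AU(.,u) has the limit
AV(0,0) at infinity, so it is constant, and the constant c = AV(0,0) does not
depend on u ([global_function_const]).  Dividing the second one by z^2, the
entire function z |-> z bU(z,u) + (u^j2 - c u^j1) equals z^(-2) bV(1/z, u/z),
which tends to 0 at infinity; hence it vanishes, and its value at z = 0 gives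
u^j2 = c u^j1 for every u ([z2_coefficient_zero]).  Behind this is the fact that
the monomial z^2 u^j is not a coboundary.  Taking u = 1 gives c = 1 and u = 2
gives j1 = j2.

What carries the argument is therefore the form of Liouville's theorem in
[entire_limit_at_infinity_const]: an entire function with a limit l at infinity
is equal to l.  It follows from the mean value property on circles.  In the
coordinate s = x + iy with z = a + exp s, the circles around a are the vertical
segments of length 2 pi, and Cauchy's theorem on the rectangle
[x0,x1] x [0,2 pi], whose horizontal sides cancel by periodicity, shows that the
integral over the circle does not depend on its radius.  It tends to 2 pi g(a)
for small radius and to 2 pi l for large radius.

Holomorphy only means complex differentiability at each point, with no
continuity of the derivative, so Cauchy's theorem is obtained by Goursat's
subdivision argument ([quadrisection], [Goursat_rectangle]). *)

(** * Complex differentiability *)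

(** The codomain is the normed module underlying the product of the ring: the
product and chain rules for [is_derive] are stated for that structure, which
has the same norm as [C_NormedModule] but a different uniform structure. *)
Local Notation entire g :=
  (forall z : C, @ex_derive C_AbsRing (AbsRing_NormedModule C_AbsRing) g z).

(** The error estimates below are all in terms of [Cmod]; this removes the
filters. *)
Lemma ex_derive_little_o (g : C -> C) (z : C) :
  @ex_derive C_AbsRing (AbsRing_NormedModule C_AbsRing) g z ->
  exists l : C, forall eps : R, 0 < eps -> exists d : R, 0 < d /\
    forall w : C, Cmod (w - z) < d ->
      Cmod (g w - g z - (w - z) * l) <= (eps * Cmod (w - z))%R.
Proof.
intros [l [_ Hl]]; exists l; intros eps Heps.
assert (Hz : is_filter_lim (@locally (AbsRing_UniformSpace C_AbsRing) z) z)
  by (intros P HP; exact HP).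
destruct (Hl z Hz (mkposreal eps Heps)) as [d Hd].
exists d; split; [apply cond_pos |].
intros w Hw; exact (Hd w Hw).
Qed.

Lemma little_o_ex_derive (g : C -> C) (z l : C) :
  (forall eps : R, 0 < eps -> exists d : R, 0 < d /\
    forall w : C, Cmod (w - z) < d ->
      Cmod (g w - g z - (w - z) * l) <= (eps * Cmod (w - z)%C)%R) ->
  @ex_derive C_AbsRing (AbsRing_NormedModule C_AbsRing) g z.
Proof.
intros H; exists l; split; [apply is_linear_scal_l |].
intros x Hx.
apply (is_filter_lim_locally_unique (V := AbsRing_NormedModule C_AbsRing)) in Hx.
change (z = x) in Hx. subst x.
intros eps; destruct (H eps (cond_pos eps)) as [d [Hd0 Hd]].
exists (mkposreal d Hd0); intros w Hw; exact (Hd w Hw).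
Qed.

Lemma entire_continuous (g : C -> C) (Hg : entire g) (z : C) :
  @continuous C_UniformSpace C_UniformSpace g z.
Proof.
intros P HP; apply locally_C.
apply (@ex_derive_continuous C_AbsRing (AbsRing_NormedModule C_AbsRing) g z (Hg z) P).
apply locally_C, HP.
Qed.

(** * Integrals of complex-valued functions of a real variable *)

Definition cint (f : R -> C) (a b : R) : C :=
  RInt (V := C_R_CompleteNormedModule) f a b.

Local Notation ccontinuous f :=
  (forall t : R, @continuous R_UniformSpace C_UniformSpace f t).

Lemma is_RInt_cint (f : R -> C) (a b : R) :
  ccontinuous f -> is_RInt (V := C_R_NormedModule) f a b (cint f a b).
Proof.
intros Hf.
apply (RInt_correct (V := C_R_CompleteNormedModule)).
apply (ex_RInt_continuous (V := C_R_CompleteNormedModule)).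
intros t _; exact (Hf t).
Qed.

Lemma is_RInt_cint_eq (f : R -> C) (a b : R) (l : C) :
  is_RInt (V := C_R_NormedModule) f a b l -> cint f a b = l.
Proof. apply (is_RInt_unique (V := C_R_CompleteNormedModule)). Qed.

Lemma cint_Chasles (f : R -> C) (a b c : R) :
  ccontinuous f -> cint f a b + cint f b c = cint f a c.
Proof.
intros Hf; apply (RInt_Chasles (V := C_R_CompleteNormedModule));
  eexists; apply is_RInt_cint, Hf.
Qed.

Lemma is_RInt_affine (u v : C) (a b : R) :
  is_RInt (V := C_R_NormedModule) (fun t : R => u + t * v) a b
    (RtoC (b - a)%R * u + RtoC ((b ^ 2 - a ^ 2) / 2)%R * v).
Proof.
assert (K : forall p q : R,
  is_RInt (fun t : R => (p + t * q)%R) a b ((b - a) * p + ((b ^ 2 - a ^ 2) / 2) * q)%R).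
{ intros p q.
  replace ((b - a) * p + ((b ^ 2 - a ^ 2) / 2) * q)%R
    with (minus (p * b + q * b ^ 2 / 2) (p * a + q * a ^ 2 / 2))%R
    by (unfold minus, plus, opp; cbn; field).
  apply (is_RInt_derive (V := R_CompleteNormedModule) (fun t => p * t + q * t ^ 2 / 2)%R).
  - intros t _; auto_derive; [trivial | field].
  - intros t _; apply (ex_derive_continuous (V := R_NormedModule)); auto_derive; trivial. }
destruct u as [u1 u2], v as [v1 v2].
assert (E : forall (r s : R), 
  (RtoC r * (u1, u2) + RtoC s * (v1, v2))%C = (r * u1 + s * v1, r * u2 + s * v2)%R).
{ intros; unfold Cplus, Cmult, RtoC; cbn; f_equal; ring. }
rewrite E.
apply (is_RInt_ext (V := C_R_NormedModule) (fun t => (u1 + t * v1, u2 + t * v2)%R)).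
- intros t _; unfold Cplus, Cmult, RtoC; cbn; f_equal; ring.
- apply (is_RInt_fct_extend_pair (U := R_NormedModule) (V := R_NormedModule)); cbn; apply K.
Qed.

Lemma Cmod_is_RInt_le (f : R -> C) (a b M : R) (l : C) :
  a <= b -> (forall t, a <= t <= b -> Cmod (f t) <= M) ->
  is_RInt (V := C_R_NormedModule) f a b l -> Cmod l <= ((b - a) * M)%R.
Proof.
intros Hab HM Hl. rewrite Cmod_norm.
refine (norm_RInt_le_const (V := C_R_NormedModule) f a b l M Hab _ Hl).
intros t Ht. rewrite <- Cmod_norm. now apply HM.
Qed.

(** * Goursat's theorem for rectangles *)

(** The integral of g(z) dz along the boundary of [a,b] x [c,d], counterclockwise. *)
Definition bd_int (g : C -> C) (a b c d : R) : C :=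
  cint (fun x => g (x, c)) a b - cint (fun x => g (x, d)) a b
  + Ci * (cint (fun y => g (b, y)) c d - cint (fun y => g (a, y)) c d).

Lemma continuous_pair (g : C -> C) (Hg : entire g) :
  (forall y, ccontinuous (fun x => g (x, y))) /\
  (forall x, ccontinuous (fun y => g (x, y))).
Proof.
split; intros s t.
- apply (continuous_comp (V := C_UniformSpace) (fun x => (x, s) : C) g).
  + apply (continuous_comp_2 (fun x => x) (fun _ => s) (fun x y => (x, y) : C)).
    apply continuous_id. apply continuous_const.
    apply (continuous_ext (fun p => p)); [now intros [] | apply continuous_id].
  + now apply entire_continuous.
- apply (continuous_comp (V := C_UniformSpace) (fun y => (s, y) : C) g).
  + apply (continuous_comp_2 (fun _ => s) (fun y => y) (fun x y => (x, y) : C)).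
    apply continuous_const. apply continuous_id. 
    apply (continuous_ext (fun p => p)); [now intros [] | apply continuous_id].
  + now apply entire_continuous.
Qed.

(** The contributions of the inner segments cancel in pairs. *)
Lemma bd_int_split (g : C -> C) (Hg : entire g) (a m b c n d : R) :
  bd_int g a b c d =
    bd_int g a m c n + bd_int g m b c n + bd_int g a m n d + bd_int g m b n d.
Proof.
destruct (continuous_pair g Hg) as [Hx Hy]; unfold bd_int.
rewrite <- (cint_Chasles (fun x => g (x, c)) a m b) by apply Hx.
rewrite <- (cint_Chasles (fun x => g (x, d)) a m b) by apply Hx.
rewrite <- (cint_Chasles (fun y => g (a, y)) c n d) by apply Hy.
rewrite <- (cint_Chasles (fun y => g (b, y)) c n d) by apply Hy.
ring.
Qed.

(** An affine integrand is integrated exactly, so only the approximation error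
remains. *)
Lemma cint_affine_approx (f : R -> C) (u v : C) (a b e : R) :
  ccontinuous f -> a <= b ->
  (forall t, a <= t <= b -> Cmod (f t - (u + t * v)) <= e) ->
  Cmod (cint f a b - (RtoC (b - a)%R * u + RtoC ((b ^ 2 - a ^ 2) / 2)%R * v))
    <= ((b - a) * e)%R.
Proof.
intros Hf Hab He.
refine (Cmod_is_RInt_le _ a b e _ Hab He _).
apply (is_RInt_minus (V := C_R_NormedModule) f);
  [now apply is_RInt_cint | apply is_RInt_affine].
Qed.

Lemma Cmod_pair_le (x y : R) : Cmod (x, y) <= (Rabs x + Rabs y)%R.
Proof.
replace ((x, y) : C) with (RtoC x + Ci * RtoC y)
  by (unfold Ci, RtoC, Cplus, Cmult; cbn; f_equal; ring).
eapply Rle_trans; [apply Cmod_triangle |].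
rewrite Cmod_mult, Cmod_Ci, !Cmod_R; lra.
Qed.

(** Differentiability at (p, q) approximates g by an affine function of z up to
o(s) on rectangles of half-perimeter s around (p, q).  The boundary integral of
the affine function vanishes, and the error is integrated over a length 2 s. *)
Lemma bd_int_small (g : C -> C) (Hg : entire g) (p q eps : R) :
  0 < eps -> exists r : R, 0 < r /\ forall a b c d : R,
    a <= p <= b -> c <= q <= d -> (b - a + (d - c) < r)%R ->
    Cmod (bd_int g a b c d) <= (eps * (b - a + (d - c)) ^ 2)%R.
Proof.
intros Heps.
destruct (ex_derive_little_o g (p, q) (Hg (p, q))) as [l Hl].
destruct (Hl (eps / 2)%R ltac:(lra)) as [r [Hr Hd]]; clear Hl.
exists r; split; [exact Hr |].
intros a b c d Hp Hq Hs.
destruct (continuous_pair g Hg) as [Cx Cy].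
set (s := (b - a + (d - c))%R) in *.
assert (Hle : forall x y : R, a <= x <= b -> c <= y <= d ->
  Cmod (g (x, y) - (g (p, q) + (RtoC x + Ci * RtoC y - (p, q)) * l))
    <= (eps / 2 * s)%R).
{ intros x y Hx Hy.
  assert (Hxy : Cmod ((x, y) - (p, q)) <= s).
  { eapply Rle_trans; [apply (Cmod_pair_le (x - p) (y - q)) |].
    unfold s; apply Rplus_le_compat; apply Rabs_le; lra. }
  replace (RtoC x + Ci * RtoC y) with ((x, y) : C)
    by (unfold Ci, RtoC, Cplus, Cmult; cbn; f_equal; ring).
  replace (g (x, y) - (g (p, q) + ((x, y) - (p, q)) * l))
    with (g (x, y) - g (p, q) - ((x, y) - (p, q)) * l) by ring.
  eapply Rle_trans; [apply Hd; lra |].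
  apply Rmult_le_compat_l; lra. }
(* The affine approximation restricted to the horizontal line at height y is
   u y + x l, and to the vertical line at abscissa x it is v x + y (i l). *)
pose (u := fun y : R => g (p, q) + (Ci * RtoC y - (p, q)) * l).
pose (v := fun x : R => g (p, q) + (RtoC x - (p, q)) * l).
assert (KH : forall y, c <= y <= d -> Cmod (cint (fun x => g (x, y)) a b -
  (RtoC (b - a)%R * u y + RtoC ((b ^ 2 - a ^ 2) / 2)%R * l))
    <= ((b - a) * (eps / 2 * s))%R).
{ intros y Hy; apply cint_affine_approx; [apply Cx | lra |].
  intros x Hx; unfold u.
  replace (g (p, q) + (Ci * y - (p, q)) * l + x * l) with
    (g (p, q) + (x + Ci * y - (p, q)) * l) by ring.
  now apply Hle. }
assert (KV : forall x, a <= x <= b -> Cmod (cint (fun y => g (x, y)) c d -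
  (RtoC (d - c)%R * v x + RtoC ((d ^ 2 - c ^ 2) / 2)%R * (Ci * l)))
    <= ((d - c) * (eps / 2 * s))%R).
{ intros x Hx; apply cint_affine_approx; [apply Cy | lra |].
  intros y Hy; unfold v.
  replace (g (p, q) + (x - (p, q)) * l + y * (Ci * l)) with
    (g (p, q) + (x + Ci * y - (p, q)) * l) by ring.
  now apply Hle. }
assert (K1 := KH c ltac:(lra)). assert (K2 := KH d ltac:(lra)).
assert (K3 := KV b ltac:(lra)). assert (K4 := KV a ltac:(lra)).
unfold bd_int.
(* The affine parts L1, ..., L4 have zero boundary sum, so the boundary integral
   is the sum of the four errors. *)
set (I1 := cint (fun x => g (x, c)) a b) in *.
set (I2 := cint (fun x => g (x, d)) a b) in *.
set (I3 := cint (fun y => g (b, y)) c d) in *.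
set (I4 := cint (fun y => g (a, y)) c d) in *.
set (L1 := (_ + _ * l)) in K1. set (L2 := (_ + _ * l)) in K2.
set (L3 := (_ + _ * _)) in K3. set (L4 := (_ + _ * _)) in K4.
replace (I1 - I2 + Ci * (I3 - I4))
  with ((I1 - L1) + - (I2 - L2) + Ci * ((I3 - L3) + - (I4 - L4)))
  by (unfold L1, L2, L3, L4, u, v; rewrite !RtoC_minus; ring).
eapply Rle_trans; [apply Cmod_triangle |].
rewrite Cmod_mult, Cmod_Ci.
assert (T1 := Cmod_triangle (I1 - L1) (- (I2 - L2))).
assert (T2 := Cmod_triangle (I3 - L3) (- (I4 - L4))).
rewrite Cmod_opp in T1, T2.
assert (Es : (eps * s ^ 2 = 2 * ((b - a) * (eps / 2 * s)) + 2 * ((d - c) * (eps / 2 * s)))%R)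
  by (unfold s; field).
rewrite Es; lra.
Qed.

Lemma nested_point (x y : nat -> R) :
  (forall n, x n <= x (S n)) -> (forall n, y (S n) <= y n) ->
  (forall n, x n <= y n) -> exists p, forall n, x n <= p <= y n.
Proof.
intros Hx Hy Hxy.
assert (Mx : forall n k, x n <= x (n + k)%nat).
{ intros n k; induction k as [| k IH]; [rewrite Nat.add_0_r; lra |].
  rewrite Nat.add_succ_r; specialize (Hx (n + k)%nat); lra. }
assert (My : forall n k, y (n + k)%nat <= y n).
{ intros n k; induction k as [| k IH]; [rewrite Nat.add_0_r; lra |].
  rewrite Nat.add_succ_r; specialize (Hy (n + k)%nat); lra. }
assert (Hb : forall n m, x m <= y n).
{ intros n m; specialize (Mx m n); specialize (My n m).
  rewrite Nat.add_comm in My; specialize (Hxy (m + n)%nat); lra. }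
destruct (completeness (fun r => exists n, r = x n)) as [p [Hp1 Hp2]].
{ exists (y O); intros r [n ->]; apply Hb. }
{ exists (x O); now exists O. }
exists p; intro n; split; [apply Hp1; now exists n |].
apply Hp2; intros r [m ->]; apply Hb.
Qed.

(** If F does not vanish on a rectangle, then repeatedly choosing the quarter on
which it is largest loses at most a factor 4 at each step, so |F| >= C t^2 along
a nested sequence of rectangles.  This contradicts the bound o(t^2) at their
common point.  Here F a c t is the value on the rectangle with lower left corner
(a, c) and sides t w and t h: fixing the shape keeps area and squared diameter
comparable. *)
Lemma quadrisection (F : R -> R -> R -> C) (w h : R) (Hw : 0 <= w) (Hh : 0 <= h)
  (Fsplit : forall a c t, F a c t =
     F a c (t / 2)%R + F (a + t / 2 * w)%R c (t / 2)%R
     + F a (c + t / 2 * h)%R (t / 2)%R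
     + F (a + t / 2 * w)%R (c + t / 2 * h)%R (t / 2)%R)
  (Fsmall : forall p q eps, 0 < eps -> exists r, 0 < r /\ forall a c t,
     0 < t < r -> a <= p <= (a + t * w)%R -> c <= q <= (c + t * h)%R ->
     Cmod (F a c t) <= (eps * t ^ 2)%R) :
  forall a c, F a c 1%R = 0.
Proof.
intros a0 c0.
set (t := fun n : nat => (/ 2 ^ n)%R).
assert (tS : forall n, (t n / 2 = t (S n))%R).
{ intro n; unfold t; cbn; field; apply pow_nonzero; lra. }
assert (t0 : forall n, 0 < t n).
{ intro n; unfold t; apply Rinv_0_lt_compat, pow_lt; lra. }
assert (step : forall (n : nat) (x : R * R), exists x' : R * R,
  ((fst x <= fst x' /\ fst x' + t (S n) * w <= fst x + t n * w) /\
  (snd x <= snd x' /\ snd x' + t (S n) * h <= snd x + t n * h) /\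
  Cmod (F (fst x) (snd x) (t n)) <= 4 * Cmod (F (fst x') (snd x') (t (S n))))%R).
{ intros n [a c]; cbn [fst snd].
  assert (E := Fsplit a c (t n)); rewrite tS in E.
  assert (Et := tS n).
  assert (Pw : 0 <= (t (S n) * w)%R) by (apply Rmult_le_pos; [left; apply t0 | trivial]).
  assert (Ph : 0 <= (t (S n) * h)%R) by (apply Rmult_le_pos; [left; apply t0 | trivial]).
  assert (Ew : (t n * w = 2 * (t (S n) * w))%R) by (rewrite <- Et; field).
  assert (Eh : (t n * h = 2 * (t (S n) * h))%R) by (rewrite <- Et; field).
  rewrite Ew, Eh.
  set (A1 := F a c (t (S n))) in E.
  set (A2 := F _ c (t (S n))) in E.
  set (A3 := F a _ (t (S n))) in E.
  set (A4 := F _ _ (t (S n))) in E.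
  assert (T1 := Cmod_triangle (A1 + A2 + A3) A4).
  assert (T2 := Cmod_triangle (A1 + A2) A3).
  assert (T3 := Cmod_triangle A1 A2).
  rewrite <- E in T1.
  destruct (Rle_lt_dec (Cmod (F a c (t n))) (4 * Cmod A1)).
  { exists (a, c); cbn [fst snd]; fold A1; lra. }
  destruct (Rle_lt_dec (Cmod (F a c (t n))) (4 * Cmod A2)).
  { exists ((a + t (S n) * w)%R, c); cbn [fst snd]; fold A2; lra. }
  destruct (Rle_lt_dec (Cmod (F a c (t n))) (4 * Cmod A3)).
  { exists (a, (c + t (S n) * h)%R); cbn [fst snd]; fold A3; lra. }
  exists ((a + t (S n) * w)%R, (c + t (S n) * h)%R); cbn [fst snd]; fold A4; lra. }
pose (next := fun n x => proj1_sig (constructive_indefinite_description _ (step n x))).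
pose (s := fix s (n : nat) : R * R :=
  match n with O => (a0, c0) | S m => next m (s m) end).
assert (Hs : forall n, 
  ((fst (s n) <= fst (s (S n)) /\ fst (s (S n)) + t (S n) * w <= fst (s n) + t n * w) /\
  (snd (s n) <= snd (s (S n)) /\ snd (s (S n)) + t (S n) * h <= snd (s n) + t n * h) /\
  Cmod (F (fst (s n)) (snd (s n)) (t n)) 
    <= 4 * Cmod (F (fst (s (S n))) (snd (s (S n))) (t (S n))))%R).
{ intro n; cbn [s]; unfold next.
  exact (proj2_sig (constructive_indefinite_description _ (step n (s n)))). }
assert (s0 : s O = (a0, c0)) by reflexivity.
clearbody s; clear next step.
destruct (nested_point (fun n => fst (s n)) (fun n => fst (s n) + t n * w)%R)
  as [p Hp].
{ intro n; apply Hs. }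
{ intro n; apply Hs. }
{ intro n; specialize (t0 n); nra. }
destruct (nested_point (fun n => snd (s n)) (fun n => snd (s n) + t n * h)%R)
  as [q Hq].
{ intro n; apply Hs. }
{ intro n; apply Hs. }
{ intro n; specialize (t0 n); nra. }
assert (Hgrow : forall n,
  (Cmod (F a0 c0 1%R) * t n ^ 2 <= Cmod (F (fst (s n)) (snd (s n)) (t n)))%R).
{ induction n as [| n IH].
  - rewrite s0; replace (t O) with 1%R by (unfold t; rewrite pow_O, Rinv_1; reflexivity); cbn [fst snd]; lra.
  - destruct (Hs n) as (_ & _ & H); rewrite <- tS in *; nra. }
apply Cmod_eq_0, Rle_antisym; [| apply Cmod_ge_0].
apply Rnot_lt_le; intro Hpos.
destruct (Fsmall p q (Cmod (F a0 c0 1%R) / 2)%R ltac:(lra)) as [r [Hr H]].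
assert (Hn : exists n, t n < r).
{ destruct (pow_lt_1_zero (/ 2)%R) with (y := r) as [N HN]; trivial.
  { rewrite Rabs_pos_eq; lra. }
  exists N; specialize (HN N (le_n N)); rewrite pow_inv in HN.
  unfold t; apply Rle_lt_trans with (2 := HN), Rle_abs. }
destruct Hn as [n Hn].
specialize (H (fst (s n)) (snd (s n)) (t n) (conj (t0 n) Hn) (Hp n) (Hq n)).
assert (G := Hgrow n); assert (0 < t n ^ 2) by (apply pow_lt, t0); nra.
Qed.

(** Subdivision starts from t = 1 with w, h the sides of the given rectangle. *)
Lemma Goursat_rectangle (g : C -> C) (Hg : entire g) (a b c d : R) :
  a <= b -> c <= d -> bd_int g a b c d = 0.
Proof.
intros Hab Hcd.
pose (F := fun x y t => bd_int g x (x + t * (b - a)) y (y + t * (d - c))).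
enough (E : F a c 1%R = 0).
{ rewrite <- E; unfold F; f_equal; ring. }
apply (quadrisection F (b - a) (d - c)); [lra | lra | |].
- intros x y t; unfold F.
  rewrite (bd_int_split g Hg x (x + t / 2 * (b - a)) _ y (y + t / 2 * (d - c)) _).
  replace (x + t / 2 * (b - a) + t / 2 * (b - a))%R
    with (x + t * (b - a))%R by field.
  replace (y + t / 2 * (d - c) + t / 2 * (d - c))%R
    with (y + t * (d - c))%R by field.
  reflexivity.
- intros p q eps Heps.
  set (l := (b - a + (d - c))%R).
  (* The half-perimeter is t l; adding 1 avoids dividing by zero on a degenerate
     rectangle. *)
  destruct (bd_int_small g Hg p q (eps / (l ^ 2 + 1))) as [r [Hr H]].
  { apply Rdiv_lt_0_compat; nra. }
  exists (r / (l + 1))%R; split.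
  { apply Rdiv_lt_0_compat; unfold l; lra. }
  intros x y t Ht Hx Hy; unfold F.
  assert (Es : (x + t * (b - a) - x + (y + t * (d - c) - y) = t * l)%R)
    by (unfold l; ring).
  assert (Hl : 0 <= l) by (unfold l; lra).
  eapply Rle_trans; [apply H; trivial |]; rewrite Es.
  + apply Rle_lt_trans with (t * (l + 1))%R; [lra |].
    destruct Ht as [_ Ht]; apply (Rmult_lt_compat_r (l + 1)) in Ht; [| lra].
    unfold Rdiv in Ht; rewrite Rmult_assoc, Rinv_l, Rmult_1_r in Ht; lra.
  + replace (eps / (l ^ 2 + 1) * (t * l) ^ 2)%R
      with ((eps * t ^ 2) * (l ^ 2 / (l ^ 2 + 1)))%R by (field; nra).
    rewrite <- (Rmult_1_r (eps * t ^ 2)) at 2.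
    apply Rmult_le_compat_l; [nra |].
    assert (0 <= l ^ 2) by apply pow2_ge_0.
    apply Rle_div_l; lra.
Qed.
(** * The complex exponential *)

Definition cexp (s : C) : C := RtoC (exp (fst s)) * (cos (snd s), sin (snd s)).

Lemma cexp_plus (s r : C) : cexp (s + r) = cexp s * cexp r.
Proof.
unfold cexp; cbn [fst snd Cplus]; rewrite exp_plus, cos_plus, sin_plus.
unfold RtoC, Cmult; cbn; f_equal; ring.
Qed.

Lemma cexp_0 : cexp 0 = 1.
Proof.
unfold cexp; cbn [fst snd RtoC]; rewrite exp_0, cos_0, sin_0.
unfold RtoC, Cmult; cbn; f_equal; ring.
Qed.

Lemma Cmod_cexp (s : C) : Cmod (cexp s) = exp (fst s).
Proof.
unfold cexp; rewrite Cmod_mult, Cmod_R, Rabs_pos_eq by (left; apply exp_pos).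
replace (Cmod (cos (snd s), sin (snd s))) with 1%R; [ring |].
unfold Cmod; cbn [fst snd]; rewrite <- sqrt_1; f_equal.
rewrite <- (sin2_cos2 (snd s)); unfold Rsqr; ring.
Qed.

Lemma is_derive_little_o (f : R -> R) (x l eps : R) : is_derive f x l -> 0 < eps ->
  exists d, 0 < d /\ forall h, Rabs h < d ->
    Rabs (f (x + h) - f x - h * l)%R <= (eps * Rabs h)%R.
Proof.
intros [_ H] Heps.
destruct (H x (fun P HP => HP) (mkposreal eps Heps)) as [d Hd].
exists d; split; [apply cond_pos |]; intros h Hh.
specialize (Hd (x + h)%R); unfold ball in Hd; cbn in Hd.
unfold AbsRing_ball, abs, minus, plus, opp in Hd; cbn in Hd.
replace (x + h + - x)%R with h in Hd by ring. 
exact (Hd Hh).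
Qed.

(** Differentiability at 0 is reduced to the first-order expansions at 0 of the
real functions exp, cos and sin; the addition formula then carries it to every
other point. *)
Lemma cexp_little_o (eps : R) : 0 < eps -> exists d, 0 < d /\
  forall h : C, Cmod h < d -> Cmod (cexp h - 1 - h) <= (eps * Cmod h)%R.
Proof.
intros Heps.
(* The error terms below add up to at most 9 e |h|; the bound e <= 1 keeps exp x
   below 3. *)
set (e := Rmin (eps / 9) 1).
assert (He : 0 < e <= 1 /\ e <= (eps / 9)%R).
{ unfold e; repeat split; [apply Rmin_glb_lt; lra | apply Rmin_r | apply Rmin_l]. }
destruct (is_derive_little_o exp 0 1 e) as [d1 [Hd1 K1]];
  [auto_derive; [trivial | rewrite exp_0; ring] | lra |].
destruct (is_derive_little_o cos 0 0 e) as [d2 [Hd2 K2]];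
  [auto_derive; [trivial | rewrite sin_0; ring] | lra |].
destruct (is_derive_little_o sin 0 1 e) as [d3 [Hd3 K3]];
  [auto_derive; [trivial | rewrite cos_0; ring] | lra |].
exists (Rmin (Rmin d1 d2) (Rmin d3 e)); split.
{ repeat apply Rmin_glb_lt; lra. }
intros [x y] Hh.
assert (H1 := Rmin_l (Rmin d1 d2) (Rmin d3 e)).
assert (H2 := Rmin_r (Rmin d1 d2) (Rmin d3 e)).
assert (H3 := Rmin_l d1 d2). assert (H4 := Rmin_r d1 d2).
assert (H5 := Rmin_l d3 e). assert (H6 := Rmin_r d3 e).
set (m := Cmod (x, y)) in *.
assert (Hx : Rabs x <= m) by (eapply Rle_trans; [apply Rmax_l | apply (Rmax_Cmod (x, y))]).
assert (Hy : Rabs y <= m) by (eapply Rle_trans; [apply Rmax_r | apply (Rmax_Cmod (x, y))]).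
specialize (K1 x ltac:(lra)); specialize (K2 y ltac:(lra)); specialize (K3 y ltac:(lra)).
rewrite Rplus_0_l, exp_0 in K1. rewrite Rplus_0_l, cos_0 in K2. rewrite Rplus_0_l, sin_0 in K3.
assert (Px := Rabs_pos x). assert (Py := Rabs_pos y).
assert (B1 : Rabs (exp x - 1) <= (2 * m)%R).
{ replace (exp x - 1)%R with ((exp x - 1 - x * 1) + x)%R by ring.
  eapply Rle_trans; [apply Rabs_triang |]; nra. }
assert (B2 : exp x <= 3).
{ apply Rabs_le_between in B1; lra. }
assert (B0 := exp_pos x).
replace (cexp (x, y) - 1 - (x, y)) with
  (RtoC (exp x - 1 - x * 1)%R + RtoC (exp x) * (RtoC (cos y - 1 - y * 0)%R + Ci * RtoC (sin y - 0 - y * 1)%R)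
   + Ci * RtoC ((exp x - 1) * y)%R)
  by (unfold cexp, Cminus, Ci, RtoC, Cplus, Copp, Cmult; cbn [fst snd]; f_equal; ring).
eapply Rle_trans; [apply Cmod_triangle |].
eapply Rle_trans; [apply Rplus_le_compat_r, Cmod_triangle |].
rewrite !Cmod_mult, Cmod_Ci.
assert (T : Cmod (RtoC (cos y - 1 - y * 0)%R + Ci * RtoC (sin y - 0 - y * 1)%R) <= (2 * (e * m))%R).
{ eapply Rle_trans; [apply Cmod_triangle |].
  rewrite Cmod_mult, Cmod_Ci, !Cmod_R; nra. }
rewrite !Cmod_R, Rabs_mult, (Rabs_pos_eq (exp x)) by lra.
assert (U : (exp x * Cmod (RtoC (cos y - 1 - y * 0)%R + Ci * RtoC (sin y - 0 - y * 1)%R) <= 3 * (2 * (e * m)))%R).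
{ apply Rmult_le_compat; try lra; apply Cmod_ge_0. }
assert (V : (Rabs (exp x - 1) * Rabs y <= 2 * m * e)%R).
{ apply Rmult_le_compat; try lra; apply Rabs_pos. }
assert (W : (e * m <= eps / 9 * m)%R) by (apply Rmult_le_compat_r; lra).
assert (X : (e * Rabs x <= e * m)%R) by (apply Rmult_le_compat_l; lra).
lra.
Qed.

Lemma entire_cexp : entire cexp.
Proof.
intros s; apply (little_o_ex_derive cexp s (cexp s)); intros eps Heps.
assert (P := exp_pos (fst s)).
destruct (cexp_little_o (eps / exp (fst s))) as [d [Hd H]].
{ now apply Rdiv_lt_0_compat. }
exists d; split; [exact Hd |]; intros r Hr.
replace (cexp r) with (cexp (s + (r - s))) by (f_equal; ring).
rewrite cexp_plus.
replace (cexp s * cexp (r - s) - cexp s - (r - s) * cexp s)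
  with (cexp s * (cexp (r - s) - 1 - (r - s))) by ring.
rewrite Cmod_mult, Cmod_cexp.
apply Rle_trans with (exp (fst s) * (eps / exp (fst s) * Cmod (r - s)))%R.
- apply Rmult_le_compat_l; [lra | now apply H].
- right; field; lra.
Qed.

(** * Entire functions with a limit at infinity *)

Lemma entire_const (c : C) : entire (fun _ => c).
Proof. intros z; apply (@ex_derive_const C_AbsRing (AbsRing_NormedModule C_AbsRing)). Qed.

Lemma entire_id : entire (fun z => z).
Proof. intros z; exists (1 : C); exact (@is_derive_id C_AbsRing z). Qed.

Lemma entire_plus (f g : C -> C) : entire f -> entire g ->
  entire (fun z => f z + g z).
Proof.
intros Hf Hg z. apply (@ex_derive_plus C_AbsRing (AbsRing_NormedModule C_AbsRing) f g z (Hf z) (Hg z)).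
Qed.

Lemma entire_mult (f g : C -> C) : entire f -> entire g ->
  entire (fun z => f z * g z).
Proof.
intros Hf Hg z; destruct (Hf z) as [df Df], (Hg z) as [dg Dg]. eexists.
apply (@is_derive_mult C_AbsRing f g z df dg Df Dg); intros; apply Cmult_comm.
Qed.

Lemma entire_comp (f g : C -> C) : entire f -> entire g ->
  entire (fun z => f (g z)).
Proof.
intros Hf Hg z; destruct (Hf (g z)) as [df Df], (Hg z) as [dg Dg]. eexists.
exact (@is_derive_comp C_AbsRing (AbsRing_NormedModule C_AbsRing) f g z df dg Df Dg).
Qed.

Lemma cexp_periodic (x : R) : cexp (x, (2 * PI)%R) = cexp (x, 0%R).
Proof. unfold cexp; cbn [fst snd]; now rewrite cos_2PI, sin_2PI, cos_0, sin_0. Qed.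

(** With respect to the angle: 2 pi times the mean of g over the circle with
centre a and radius exp x. *)
Definition circle_int (g : C -> C) (a : C) (x : R) : C :=
  cint (fun y => g (a + cexp (x, y))) 0%R (2 * PI)%R.

Lemma entire_polar (g : C -> C) (a : C) :
  entire g -> entire (fun s => g (a + cexp s)).
Proof.
intros Hg; apply (entire_comp g); [exact Hg |].
apply entire_plus; [apply entire_const | apply entire_cexp].
Qed.

(** Goursat's theorem for s |-> g(a + exp s) on [x0,x1] x [0,2 pi]: the
horizontal sides have equal integrals by periodicity, so the vertical sides do
too. *)
Lemma circle_int_const (g : C -> C) (a : C) (Hg : entire g) (x0 x1 : R) :
  x0 <= x1 -> circle_int g a x0 = circle_int g a x1.
Proof.
intros Hx.
assert (H := Goursat_rectangle _ (entire_polar g a Hg) x0 x1 0 (2 * PI) Hx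
  ltac:(assert (P := PI_RGT_0); lra)).
unfold bd_int in H.
assert (E : cint (fun x => g (a + cexp (x, (2 * PI)%R))) x0 x1
  = cint (fun x => g (a + cexp (x, 0%R))) x0 x1).
{ apply (RInt_ext (V := C_R_CompleteNormedModule)); intros x _; now rewrite cexp_periodic. }
rewrite E in H; clear E.
apply (Cmult_inj Ci); [intros Hi; injection Hi; lra |].
fold (circle_int g a x0) (circle_int g a x1) in H.
replace (Ci * circle_int g a x0) with
  (Ci * circle_int g a x1 - Ci * (circle_int g a x1 - circle_int g a x0)) by ring.
assert (H' : Ci * (circle_int g a x1 - circle_int g a x0) = 0)
  by (rewrite <- H; ring).
rewrite H'; ring.
Qed.

Lemma circle_int_approx (g : C -> C) (a l : C) (x e : R) (Hg : entire g) :
  (forall y, Cmod (g (a + cexp (x, y)) - l) <= e) ->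
  Cmod (circle_int g a x - RtoC (2 * PI)%R * l) <= (2 * PI * e)%R.
Proof.
intros He; assert (P := PI_RGT_0).
assert (H := cint_affine_approx (fun y => g (a + cexp (x, y))) l 0 0 (2 * PI) e).
rewrite Rminus_0_r, Cmult_0_r, Cplus_0_r in H; apply H; [| lra |].
- apply (continuous_pair _ (entire_polar g a Hg)).
- intros t _; rewrite Cmult_0_r, Cplus_0_r; apply He.
Qed.

(** The mean of g over a small circle around a is close to g(a), over a large
one it is close to l, and the two means are equal. *)
Lemma entire_limit_at_infinity_const (g : C -> C) (l : C) :
  entire g ->
  (forall eps : R, 0 < eps -> exists M : R, forall z : C,
     M < Cmod z -> Cmod (g z - l) <= eps) ->
  forall a : C, g a = l.
Proof.
intros Hg Hinf a.
assert (P := PI_RGT_0).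
enough (E : Cmod (g a - l) <= 0).
{ replace (g a) with (g a - l + l) by ring.
  rewrite (Cmod_eq_0 (g a - l)); [ring | apply Rle_antisym; [exact E | apply Cmod_ge_0]]. }
apply Rnot_lt_le; intro Hpos.
(* Each mean is within e of its limit, and 2 e < |g(a) - l|. *)
set (e := (Cmod (g a - l) / 3)%R).
assert (He : 0 < e) by (unfold e; lra).
destruct (Hinf e He) as [M HM].
destruct (@ex_derive_continuous C_AbsRing (AbsRing_NormedModule C_AbsRing)
  g a (Hg a) _ (locally_ball_norm (K := C_AbsRing)
    (V := AbsRing_NormedModule C_AbsRing) (g a) (mkposreal e He))) as [r Hr].
assert (Hr' : forall z, Cmod (z - a) < r -> Cmod (g z - g a) < e) by exact Hr.
set (x1 := ln (Rabs M + Cmod a + 1)).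
set (x0 := Rmin x1 (ln (r / 2))).
assert (Hr0 := cond_pos r).
assert (E0 : exp x0 <= (r / 2)%R).
{ rewrite <- (exp_ln (r / 2)) by lra.
  destruct (Rmin_r x1 (ln (r / 2))) as [H | H]; unfold x0;
    [left; now apply exp_increasing | right; now rewrite H]. }
assert (E1 : exp x1 = (Rabs M + Cmod a + 1)%R).
{ unfold x1; apply exp_ln; assert (A := Rabs_pos M); assert (B := Cmod_ge_0 a); lra. }
assert (K0 : Cmod (circle_int g a x0 - RtoC (2 * PI)%R * g a) <= (2 * PI * e)%R).
{ apply circle_int_approx; [exact Hg |]; intro y; left; apply Hr'.
  replace (a + cexp (x0, y) - a) with (cexp (x0, y)) by ring.
  rewrite Cmod_cexp; cbn [fst]; lra. }
assert (K1 : Cmod (circle_int g a x1 - RtoC (2 * PI)%R * l) <= (2 * PI * e)%R).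
{ apply circle_int_approx; [exact Hg |]; intro y; apply HM.
  assert (T := Cmod_triangle (a + cexp (x1, y)) (- a)).
  replace (a + cexp (x1, y) + - a) with (cexp (x1, y)) in T by ring.
  rewrite Cmod_cexp, Cmod_opp in T; cbn [fst] in T.
  assert (A := Rle_abs M); lra. }
rewrite (circle_int_const g a Hg x0 x1) in K0 by apply Rmin_l.
set (I := circle_int g a x1) in *.
assert (T := Cmod_triangle (I - RtoC (2 * PI)%R * l) (- (I - RtoC (2 * PI)%R * g a))).
rewrite Cmod_opp in T.
replace (I - RtoC (2 * PI)%R * l + - (I - RtoC (2 * PI)%R * g a))
  with (RtoC (2 * PI)%R * (g a - l)) in T by ring.
rewrite Cmod_mult, Cmod_R, Rabs_pos_eq in T by lra.
unfold e in *; nra.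
Qed.

(** * The two charts of the base *)

(** The partial derivative is the differential applied to (1, 0): that the
differential is C-linear is what makes it a complex derivative. *)
Lemma holomorphic2_slice (f : C * C -> C) (u : C) :
  holomorphic2 f -> entire (fun z => f (z, u)).
Proof.
intros Hf z.
destruct (Hf (z, u)) as [df [Hlin Hdom]].
apply (little_o_ex_derive _ z (df (1 : C, 0 : C))); intros eps Heps.
destruct (Hdom (z, u) (fun P HP => HP) (mkposreal eps Heps)) as [d Hd].
exists d; split; [apply cond_pos |]; intros w Hw.
assert (Hball : @ball (prod_UniformSpace C_UniformSpace C_UniformSpace) (z, u) d (w, u)).
{ split; [| apply ball_center].
  apply C_NormedModule_mixin_compat1, Hw. }
specialize (Hd (w, u) Hball); cbn [pos] in Hd.
replace (df (minus (G := prod_NormedModule C_AbsRing C_NormedModule C_NormedModule) (w, u) (z, u)))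
  with (((w - z) * df (1 : C, 0 : C)) : C) in Hd.
2: { rewrite <- (linear_scal _ Hlin). f_equal.
  cbv -[Cplus Cmult Copp Cminus RtoC]. f_equal; ring. }
refine (Rle_trans _ _ _ Hd _).
apply Rmult_le_compat_l; [lra | right].
change (sqrt (Cmod (w - z) ^ 2 + Cmod (u - u) ^ 2) = Cmod (w - z)).
replace (u - u) with (RtoC 0) by ring; rewrite Cmod_0.
rewrite pow_i, Rplus_0_r by lia.
rewrite <- (sqrt_pow2 (Cmod (w - z))) at 2 by apply Cmod_ge_0; reflexivity.
Qed.

(** As z tends to infinity with u fixed, the point (z, u) of the first chart
tends to the origin of the second one. *)
Lemma holomorphic2_limit_at_infinity (f : C * C -> C) (u : C) (eps : R) :
  holomorphic2 f -> 0 < eps -> exists M : R, 0 < M /\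
  forall z : C, M < Cmod z -> Cmod (f (/ z, / z * u) - f (RtoC 0, RtoC 0)) <= eps.
Proof.
intros Hf Heps.
destruct (filterdiff_continuous f (RtoC 0, RtoC 0) (Hf (RtoC 0, RtoC 0)) _
  (locally_ball_norm (K := C_AbsRing) (V := C_NormedModule)
    (f (RtoC 0, RtoC 0)) (mkposreal eps Heps))) as [r Hr].
assert (Hr0 := cond_pos r); assert (Hu := Cmod_ge_0 u).
assert (HM : 0 < ((1 + Cmod u) / r)%R) by (apply Rdiv_lt_0_compat; lra).
exists ((1 + Cmod u) / r)%R; split; [exact HM |]; intros z Hz.
assert (Hzr : (1 + Cmod u < r * Cmod z)%R).
{ apply (Rmult_lt_compat_l r) in Hz; [| exact Hr0].
  replace (r * ((1 + Cmod u) / r))%R with (1 + Cmod u)%R in Hz by (field; lra).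
  exact Hz. }
assert (Hz0 : z <> 0) by (apply Cmod_gt_0; lra).
assert (Hinv : forall v, Cmod v <= (1 + Cmod u)%R -> Cmod (/ z * v - 0) < r).
{ intros v Hv; replace (/ z * v - 0) with (v / z) by (unfold Cdiv; ring).
  rewrite Cmod_div by exact Hz0.
  apply Rlt_div_l; lra. }
left; apply (Hr (/ z, / z * u)); split; apply C_NormedModule_mixin_compat1.
- change (Cmod (/ z - 0) < r).
  replace (/ z - 0) with (/ z * 1 - 0) by ring.
  apply Hinv; rewrite Cmod_1; lra.
- apply Hinv; lra.
Qed.

Lemma E_trans (j : nat) (z u1 u2 : C) : z <> 0 ->
  E_U j z u1 u2 = E_V j (/ z) (z ^ 3 * u1 + z ^ 2 * u2 ^ j) (/ z * u2).
Proof. intros Hz; apply W_class_eq; exact (glue_UV W_dom (W_trans j) (z, u1, u2) Hz). Qed.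

Lemma E_V_inj (j : nat) (xi v1 v1' v2 : C) :
  E_V j xi v1 v2 = E_V j xi v1' v2 -> v1 = v1'.
Proof. intros H; apply W_class_eq in H; inversion H; reflexivity. Qed.

(** Both chart expressions of T are applied to the point with fibre coordinate
u1; the coefficients of u1 and the constant terms are then compared. *)
Lemma affine_iso_compat (j1 j2 : nat) : affine_isomorphic j1 j2 ->
  exists AU AV bU bV : C * C -> C,
    holomorphic2 AU /\ holomorphic2 AV /\ holomorphic2 bU /\ holomorphic2 bV /\
    forall z u : C, z <> 0 ->
      AU (z, u) = AV (/ z, / z * u) /\
      z ^ 3 * bU (z, u) + z ^ 2 * u ^ j2
        = AV (/ z, / z * u) * (z ^ 2 * u ^ j1) + bV (/ z, / z * u).
Proof.
intros (T & _ & AU & AV & bU & bV & HAU & HAV & HbU & HbV & _ & _ & HU & HV).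
exists AU, AV, bU, bV; repeat split; trivial.
all: assert (K : forall u1,
  z ^ 3 * (AU (z, u) * u1 + bU (z, u)) + z ^ 2 * u ^ j2
  = AV (/ z, / z * u) * (z ^ 3 * u1 + z ^ 2 * u ^ j1) + bV (/ z, / z * u)) by
  (intro u1; apply (E_V_inj j2 (/ z) _ _ (/ z * u));
   rewrite <- HV, <- !E_trans by assumption; symmetry; apply HU).
- apply (Cmult_inj (z ^ 3)); [now apply Cpow_nz |].
  assert (K0 := K 0). assert (K1 := K 1).
  replace (z ^ 3 * AU (z, u)) with
    ((z ^ 3 * (AU (z, u) * 1 + bU (z, u)) + z ^ 2 * u ^ j2)
     - (z ^ 3 * (AU (z, u) * 0 + bU (z, u)) + z ^ 2 * u ^ j2)) by ring.
  rewrite K0, K1; ring.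
- assert (K0 := K 0).
  replace (z ^ 3 * bU (z, u)) with (z ^ 3 * (AU (z, u) * 0 + bU (z, u))) by ring.
  rewrite K0; ring.
Qed.

(** The zero section of the bundle has positive self-intersection, so that the
surface has only constant global functions. *)
Lemma global_function_const (AU AV : C * C -> C) :
  holomorphic2 AU -> holomorphic2 AV ->
  (forall z u : C, z <> 0 -> AU (z, u) = AV (/ z, / z * u)) ->
  forall z u : C, AU (z, u) = AV (RtoC 0, RtoC 0).
Proof.
intros HU HV H z u.
apply (entire_limit_at_infinity_const (fun z : C => AU (z, u))).
- now apply holomorphic2_slice.
- intros eps Heps.
  destruct (holomorphic2_limit_at_infinity AV u eps HV Heps) as [M [HM K]].
  exists M; intros w Hw; rewrite H; [now apply K |].
  apply Cmod_gt_0; lra.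
Qed.

(** A form of the non-triviality of the class of z^2 u^j: bU(z,u) contributes the
powers z^3, z^4, ..., and bV(1/z, u/z) no positive power, so nothing can produce
z^2. *)
Lemma z2_coefficient_zero (bU bV : C * C -> C) (u k : C) :
  holomorphic2 bU -> holomorphic2 bV ->
  (forall z : C, z <> 0 -> z ^ 3 * bU (z, u) + z ^ 2 * k = bV (/ z, / z * u)) ->
  k = 0.
Proof.
intros HU HV H.
replace k with (0 * bU (RtoC 0, u) + k) by ring.
apply (entire_limit_at_infinity_const (fun z : C => z * bU (z, u) + k)).
- apply entire_plus; [| apply entire_const].
  apply entire_mult; [apply entire_id | now apply holomorphic2_slice].
- intros eps Heps.
  destruct (holomorphic2_limit_at_infinity bV u 1 HV Rlt_0_1) as [M [HM K]].
  set (B := (1 + Cmod (bV (RtoC 0, RtoC 0)))%R).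
  assert (HB : 0 < B) by (unfold B; assert (X := Cmod_ge_0 (bV (RtoC 0, RtoC 0))); lra).
  exists (Rmax M (Rmax 1 (B / eps))); intros z Hz.
  assert (H1 := Rmax_l M (Rmax 1 (B / eps))).
  assert (H2 := Rmax_r M (Rmax 1 (B / eps))).
  assert (H3 := Rmax_l 1 (B / eps)). assert (H4 := Rmax_r 1 (B / eps)).
  assert (Hz0 : z <> 0) by (apply Cmod_gt_0; lra).
  assert (Hb : Cmod (bV (/ z, / z * u)) <= B).
  { replace (bV (/ z, / z * u))
      with (bV (/ z, / z * u) - bV (RtoC 0, RtoC 0) + bV (RtoC 0, RtoC 0)) by ring.
    eapply Rle_trans; [apply Cmod_triangle |].
    apply Rplus_le_compat_r, K; lra. }
  replace (z * bU (z, u) + k - 0)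
    with ((z ^ 3 * bU (z, u) + z ^ 2 * k) / z ^ 2) by (field; exact Hz0).
  rewrite H, Cmod_div, Cmod_pow by (trivial; now apply Cpow_nz).
  assert (Be : B <= (eps * Cmod z)%R).
  { replace B with (eps * (B / eps))%R by (field; lra).
    apply Rmult_le_compat_l; lra. }
  apply Rle_div_l; [apply pow_lt; lra |].
  assert (eps * Cmod z <= eps * Cmod z ^ 2)%R; [| lra].
  apply Rmult_le_compat_l; [lra |]; nra.
Qed.

Theorem theorem1p21 (j1 j2 : nat) (hj1 : (0 < j1)%nat) (hj2 : (0 < j2)%nat)
  (hne : j1 <> j2) : ~ affine_isomorphic j1 j2.
Proof.
intros Hiso.
destruct (affine_iso_compat j1 j2 Hiso)
  as (AU & AV & bU & bV & HAU & HAV & HbU & HbV & H).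
assert (HA : forall z u : C, AU (z, u) = AV (RtoC 0, RtoC 0)).
{ apply global_function_const; trivial; intros z u Hz; apply (H z u Hz). }
set (c := AV (RtoC 0, RtoC 0)) in *.
assert (Hu : forall u : C, u ^ j2 = c * u ^ j1).
{ intro u.
  enough (E : u ^ j2 - c * u ^ j1 = 0).
  { replace (u ^ j2) with (u ^ j2 - c * u ^ j1 + c * u ^ j1) by ring.
    rewrite E; ring. }
  apply (z2_coefficient_zero bU bV u); trivial.
  intros z Hz; destruct (H z u Hz) as [H1 H2].
  rewrite <- H1, HA in H2.
  replace (z ^ 3 * bU (z, u) + z ^ 2 * (u ^ j2 - c * u ^ j1))
    with (z ^ 3 * bU (z, u) + z ^ 2 * u ^ j2 - c * (z ^ 2 * u ^ j1)) by ring.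
  rewrite H2; ring. }
assert (Hc : c = 1).
{ assert (E := Hu 1); rewrite !Cpow_1_l in E. rewrite E; ring. }
assert (E := f_equal Cmod (Hu (RtoC 2))).
rewrite Hc, Cmult_1_l, !Cmod_pow, Cmod_R, Rabs_pos_eq in E by lra.
destruct (Nat.lt_total j1 j2) as [L | [L | L]]; [| contradiction |].
- apply (Rlt_pow 2) in L; lra.
- apply (Rlt_pow 2) in L; lra.
Qed.
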